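(* Let $a$ and $b$ be even integers with $a > b \geq 2$. Then the equation $3^{a}+3^{b}+2=n^5$ has no solution in positive integers $n$; that is, there is no triple $(a,b,n)$ of positive integers with $a$ and $b$ both even, $a>b\geq 2$, and $3^{a}+3^{b}+2=n^5$.
   Context: ''Insoluble'' means there are no solutions in positive integers. All variables $a,b,n$ are positive integers. *)

(* Defs.v *)
From mathcomp Require Export all_boot.

(* Main.v *)
Require Import Defs.
From mathcomp Require Import all_boot.

(** The obstruction is 2-adic. An even power of 3 is a power of 9, hence 1
    modulo 8, so the left-hand side is 4 modulo 8, that is, exactly divisible
    by 4. A fifth power is either odd or divisible by 32, so it is never
    4 modulo 8. *)

Lemma expn3_even_mod8 k : ~~ odd k -> 3 ^ k = 1 %[mod 8].
Proof.
move=> k_even; rewrite -(even_halfK k_even) -mul2n expnM.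
by rewrite -modnXm exp1n.
Qed.

Lemma expn5_mod8_neq4 n : n ^ 5 %% 8 != 4.
Proof.
rewrite -modnXm.
have: n %% 8 < 8 by rewrite ltn_mod.
by case: (n %% 8) => [|[|[|[|[|[|[|[|r]]]]]]]].
Qed.

Theorem lemma1 (a b n : nat) (ha : ~~ odd a) (hb : ~~ odd b)
  (hb2 : 2 <= b) (hab : b < a) (hn : 0 < n) :
  3 ^ a + 3 ^ b + 2 <> n ^ 5.
Proof.
move=> sum_eq; have /eqP[] := expn5_mod8_neq4 n.
rewrite -sum_eq -modnDml -(modnDm (3 ^ a)).
by rewrite (expn3_even_mod8 _ ha) (expn3_even_mod8 _ hb).
Qed.
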